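(* Let $k\ge 3$, let $F_k$ be the free group on $\gamma_1,\dots,\gamma_k$, and let $$\operatorname{crit}(T)=\bigcup_{i=3}^k\{t_{12i}=t_{21i}\}\cup\{t_{12\bar1\bar2}=2\}\subset\mathcal R^*(F_k,\mathrm{SL}_2(\mathbb C)).$$ Then on $\mathcal R^*(F_k,\mathrm{SL}_2(\mathbb C))\setminus\operatorname{crit}(T)$ the holomorphic volume form $\Omega_{F_k}$ is $$\Omega_{F_k}=\pm 2\sqrt2\; dt_1\wedge dt_2\wedge dt_{12}\wedge\bigwedge_{i=3}^k\sqrt2\,\frac{dt_i\wedge dt_{1i}\wedge dt_{2i}}{t_{12i}-t_{21i}} .$$
   Context: Notation: $t_{i_1\cdots i_l}$ is the function $[\rho]\mapsto\operatorname{tr}\rho(\gamma_{i_1}\cdots\gamma_{i_l})$, with the convention $\gamma_{\bar i}=\gamma_i^{-1}$. A representation $\rho\colon F_k\to\mathrm{SL}_2(\mathbb C)$ is good if its image is contained in no proper parabolic subgroup (i.e. it is irreducible) and its centralizer is the center of $\mathrm{SL}_2(\mathbb C)$. $\mathcal R^*(F_k,\mathrm{SL}_2(\mathbb C))$ is the set of conjugacy classes of good representations, a complex manifold of dimension $3k-3$ with $T_{[\rho]}\mathcal R^*(F_k,\mathrm{SL}_2(\mathbb C))\cong H^1(F_k;\operatorname{Ad}\rho)$ (the path $\rho_s$ corresponds to the class of the cocycle $\gamma\mapsto\frac{d}{ds}\rho_s(\gamma)\rho(\gamma)^{-1}|_{s=0}$). Volume form $\Omega_{F_k}$ (Reidemeister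 torsion, defined up to sign): let $\mathcal B(X,Y)=-\operatorname{tr}(XY)$ on $\mathfrak g=\mathfrak{sl}_2(\mathbb C)$. Let $C^0=\mathfrak g$, $C^1=\mathfrak g^k$, $\delta(X)=(\operatorname{Ad}_{\rho(\gamma_i)}X-X)_{i=1}^k$, so that $H^1(F_k;\operatorname{Ad}\rho)=C^1/\operatorname{Im}\delta$. Let $\mathbf c^0$ be a $\mathcal B$-orthonormal basis of $\mathfrak g$ and $\mathbf c^1$ the corresponding basis of $\mathfrak g^k$. For a basis $\mathbf h$ of $H^1(F_k;\operatorname{Ad}\rho)$ with representatives $\widetilde{\mathbf h}\subset C^1$, $\Omega_{F_k}(\wedge\mathbf h)=\pm[\delta\mathbf c^0\sqcup\widetilde{\mathbf h}:\mathbf c^1]$, where $[\mathbf a:\mathbf b]$ is the determinant of the matrix expressing $\mathbf a$ in terms of $\mathbf b$ and $\wedge\mathbf h$ is the exterior product of the elements of $\mathbf h$. *)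

(* Defs.v *)
From HB Require Import structures.
From mathcomp Require Import all_boot all_order all_algebra.
From mathcomp Require Import all_classical all_reals all_analysis.
From mathcomp Require Import complex.
Import Order.TTheory GRing.Theory Num.Theory.
Import numFieldNormedType.Exports.

Set Implicit Arguments.
Unset Strict Implicit.
Unset Printing Implicit Defensive.

Local Open Scope classical_set_scope.
Local Open Scope ring_scope.

(* Declaring R[i] at type numClosedFieldType gives [CC R] the topology that the
   library puts on the carrier of any numFieldType. *)
Definition CC (R : realType) : numClosedFieldType := R[i].

Section SL2.
Variable R : realType.

Record SL2 := MkSL2 { SL2val :> 'M[CC R]_2; _ : \det SL2val == 1 }.
HB.instance Definition _ := [isSub for SL2val].
HB.instance Definition _ := [Choice of SL2 by <:].

Lemma SL2_det (g : SL2) : \det g = 1.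
Proof. by apply/eqP; case: g. Qed.

Lemma SL2_unit (g : SL2) : (g : 'M[CC R]_2) \in unitmx.
Proof. by rewrite unitmxE SL2_det unitr1. Qed.

Fact SL2_one_subproof : \det (1%:M : 'M[CC R]_2) == 1.
Proof. by rewrite det1. Qed.
Fact SL2_mul_subproof (g h : SL2) : \det (g *m h) == 1.
Proof. by rewrite det_mulmx !SL2_det mulr1. Qed.
Fact SL2_inv_subproof (g : SL2) : \det (invmx g) == 1.
Proof. by rewrite det_inv SL2_det invr1. Qed.

Definition SL2_one := MkSL2 SL2_one_subproof.
Definition SL2_mul g h := MkSL2 (SL2_mul_subproof g h).
Definition SL2_inv g := MkSL2 (SL2_inv_subproof g).

Fact SL2_mulA : associative SL2_mul.
Proof. by move=> x y z; apply: val_inj; rewrite /= mulmxA. Qed.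
Fact SL2_mul1g : left_id SL2_one SL2_mul.
Proof. by move=> x; apply: val_inj; rewrite /= mul1mx. Qed.
Fact SL2_mulg1 : right_id SL2_one SL2_mul.
Proof. by move=> x; apply: val_inj; rewrite /= mulmx1. Qed.
Fact SL2_mulVg : left_inverse SL2_one SL2_inv SL2_mul.
Proof. by move=> x; apply: val_inj; rewrite /= mulVmx ?SL2_unit. Qed.
Fact SL2_mulgV : right_inverse SL2_one SL2_inv SL2_mul.
Proof. by move=> x; apply: val_inj; rewrite /= mulmxV ?SL2_unit. Qed.

HB.instance Definition _ :=
  isGroup.Build SL2 SL2_mulA SL2_mul1g SL2_mulg1 SL2_mulVg SL2_mulgV.

Definition sl2_space : {vspace 'M[CC R]_2} :=
  lker (linfun (@mxtrace (CC R) 2 : 'M[CC R]_2 -> (CC R)^o)).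

Definition sl2 := subvs_of sl2_space.

Lemma sl2_spaceE (X : 'M[CC R]_2) : (X \in sl2_space) = (\tr X == 0).
Proof. by rewrite memv_ker lfunE. Qed.

Definition Ad (g : SL2) (X : sl2) : sl2 :=
  vsproj sl2_space ((g : 'M[CC R]_2) *m vsval X *m invmx g).

Lemma AdE (g : SL2) (X : sl2) :
  vsval (Ad g X) = (g : 'M[CC R]_2) *m vsval X *m invmx g.
Proof.
rewrite vsprojK // sl2_spaceE mxtrace_mulC mulmxA mulVmx ?SL2_unit // mul1mx.
by rewrite -sl2_spaceE subvsP.
Qed.

Definition Bform (X Y : sl2) : CC R := - \tr (vsval X *m vsval Y).

Definition orthonormal_basis (c0 : 3.-tuple sl2) : Prop :=
  basis_of fullv c0 /\
  forall i j, Bform (tnth c0 i) (tnth c0 j) = (i == j)%:R.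

(* The proper parabolic subgroups of SL_2(C) are the stabilizers of the lines
   of C^2. *)
Definition parabolic (v : 'cV[CC R]_2) : set SL2 :=
  [set g | exists a : CC R, (g : 'M[CC R]_2) *m v = a *: v].

Definition SL2_center : set SL2 := [set g | forall h : SL2, commute g h].

End SL2.

Arguments SL2_center R : clear implicits.

Definition is_free_group (k : nat) (F : groupType) (gam : 'I_k -> F) : Prop :=
  forall (G : groupType) (g : 'I_k -> G),
    exists f : {multiplicative F -> G},
      (forall i, f (gam i) = g i) /\
      forall f' : {multiplicative F -> G},
        (forall i, f' (gam i) = g i) -> f' =1 f.

(* The generators numbered from 1 to k; the value outside this range is a
   dummy. *)
Definition gen (k : nat) (F : groupType) (gam : 'I_k -> F) (j : nat) : F :=
  odflt 1%g (omap gam (insub j.-1)).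

Section Representations.
Variables (R : realType) (F : groupType).

Definition rep := {multiplicative F -> SL2 R}.

Definition irreducible_rep (rho : rep) : Prop :=
  forall v : 'cV[CC R]_2, v != 0 -> ~ (range rho `<=` parabolic v).

Definition centralizer_rep (rho : rep) : set (SL2 R) :=
  [set g | forall x : F, commute g (rho x)].

Definition good (rho : rep) : Prop :=
  irreducible_rep rho /\ centralizer_rep rho = SL2_center R.

Definition conj_class (rho : rep) : set rep :=
  [set rho' | exists g : SL2 R, forall x : F, rho' x = (g * rho x * g^-1)%g].

Definition Rstar : set (set rep) :=
  [set conj_class rho | rho in [set rho | good rho]].

(* The trace function of x on conjugacy classes: all the elements of a class
   share the same trace at x, see [trfE]. *)
Definition trf (x : F) (c : set rep) : CC R :=
  xget 0 [set \tr (rho x : 'M[CC R]_2) | rho in c].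

Lemma trfE (x : F) (rho : rep) :
  trf x (conj_class rho) = \tr (rho x : 'M[CC R]_2).
Proof.
rewrite /trf; case: xgetP => [_ _ [rho' [g ->] <-]|].
  by rewrite /= mxtrace_mulC mulmxA mulVmx ?SL2_unit // mul1mx.
move/(_ (\tr (rho x : 'M[CC R]_2))) => /= []; exists rho => //.
by exists 1%g => y; rewrite mul1g invg1 mulg1.
Qed.

End Representations.

Arguments Rstar R F : clear implicits.

Section VolumeForm.
Variables (R : realType) (k : nat) (F : groupType) (gam : 'I_k -> F).

Let C := CC R.
Let t (x : F) := @trf R F x.
Let g := gen gam.

Definition C1 := {ffun 'I_k -> sl2 R}.

Definition delta (rho : rep R F) (X : sl2 R) : C1 :=
  [ffun i => Ad (rho (gam i)) X - X].

(* The classes of the members of h form a basis of the quotient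
   H^1(F_k; Ad rho) of C1 by the image of delta. *)
Definition H1_basis (rho : rep R F) (n : nat) (h : n.-tuple C1) : Prop :=
  forall x : C1, exists! a : 'rV[C]_n,
    exists X : sl2 R, x = \sum_(j < n) a ord0 j *: tnth h j + delta rho X.

(* [bracket a b] is [a : b]: the j-th column consists of the coordinates of the
   j-th member of a in the basis b. *)
Definition bracket (V : vectType C) (a b : seq V) : C :=
  \det (\matrix_(i < size b, j < size b) coord (in_tuple b) i (nth 0 a j)).

Definition C1_basis (c0 : seq (sl2 R)) : seq C1 :=
  [seq [ffun j => if j == i then X else 0] | i <- enum 'I_k, X <- c0].

Definition Omega (c0 : seq (sl2 R)) (rho : rep R F) (h : seq C1) : C :=
  bracket (map (delta rho) c0 ++ h) (C1_basis c0).

(* p is a path of representations through rho whose initial velocity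
   d/ds (p s)(gamma) rho(gamma)^-1 is a cocycle in the class of u; a cocycle is
   given by its values at the generators. *)
Definition tangent_path (rho : rep R F) (u : C1) (p : C -> rep R F) : Prop :=
  p 0 =1 rho /\
  exists X : sl2 R, forall (i : 'I_k) (a b : 'I_2),
    is_derive (0 : C) (1 : C)
      (fun s : C => ((p s (gam i) : 'M[C]_2) *m invmx (rho (gam i))) a b)
      (vsval ((u + delta rho X) i) a b).

(* The differential at [rho], evaluated at the class of u, of a function f on
   the set of conjugacy classes. *)
Definition dif (f : set (rep R F) -> C) (rho : rep R F) (u : C1) : C :=
  xget 0 [set d : C | exists p : C -> rep R F, tangent_path rho u p /\
    is_derive (0 : C) (1 : C) (fun s : C => f (conj_class (p s))) d].

(* (a_1 /\ ... /\ a_n)(v_1 /\ ... /\ v_n) = det (a_i v_j). *)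
Definition wedge (V : zmodType) (a : seq (V -> C)) (v : seq V) : C :=
  \det (\matrix_(i < size a, j < size a) nth (fun=> 0) a i (nth 0 v j)).

Definition crit : set (set (rep R F)) :=
  Rstar R F `&`
  (\bigcup_(i in [set i : nat | (3 <= i <= k)%N])
     [set c | t (g 1 * g 2 * g i)%g c = t (g 2 * g 1 * g i)%g c]
   `|` [set c | t (g 1 * g 2 * (g 1)^-1 * (g 2)^-1)%g c = 2]).

(* dt_1, dt_2, dt_12, then dt_i, dt_1i, dt_2i for i = 3, ..., k. *)
Definition trace_forms (rho : rep R F) : seq (C1 -> C) :=
  [:: dif (t (g 1)) rho; dif (t (g 2)) rho; dif (t (g 1 * g 2)%g) rho] ++
  flatten [seq [:: dif (t (g i)) rho; dif (t (g 1 * g i)%g) rho;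
                   dif (t (g 2 * g i)%g) rho] | i <- index_iota 3 k.+1].

Definition trace_volume (rho : rep R F) (h : seq C1) : C :=
  2 * sqrtC 2 *
  (\prod_(3 <= i < k.+1)
     (sqrtC 2 / (t (g 1 * g 2 * g i)%g (conj_class rho)
                 - t (g 2 * g 1 * g i)%g (conj_class rho)))) *
  wedge (trace_forms rho) h.

End VolumeForm.

Arguments crit R {k F} gam.

(* Main.v *)
Require Import Defs.
From HB Require Import structures.
From mathcomp Require Import all_boot all_order all_algebra.
From mathcomp Require Import perm.
From mathcomp Require Import all_classical all_reals all_analysis.
From mathcomp Require Import complex.
From mathcomp Require Import ring.
Import Order.TTheory GRing.Theory Num.Theory.
Import numFieldNormedType.Exports.
Local Open Scope classical_set_scope.
Local Open Scope ring_scope.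

Set Implicit Arguments.
Unset Strict Implicit.
Unset Printing Implicit Defensive.

(* The differentials of the 3k-3 trace functions are linear forms on
   C^1 = sl_2^k that vanish on the image of delta.  Adding three auxiliary forms
   E gives 3k forms, and applying them to (delta c0, h) gives
     det(E, dt) * Omega(h) = det(E o delta) * (dt_1 /\ dt_2 /\ ...)(h).
   With E(u) = (tr(u_1 A_2), tr(u_1 A_1 A_2), tr(u_2 A_1)), A_i = rho(gamma_i), the
   matrix of (E, dt) in the basis c^1 is block triangular with 3x3 blocks, up to one
   exchange of rows.  Every 3x3 determinant that occurs is d = det c0, with
   d^2 = 1/2, times a polynomial in the entries of the A_i: with
   kappa = tr[A_1,A_2] - 2 and tau_i = t_12i - t_21i one finds
     det(E, dt) = (kappa d)^2 * prod_i (- tau_i d),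
     det(E o delta) = - 2 kappa^2 d,
   and kappa and the tau_i are nonzero off crit(T). *)

(** * Determinants indexed by natural numbers *)

Section NatIndexedDeterminants.
Variable A : comNzRingType.
Implicit Types f g : nat -> nat -> A.

(** Natural-number indices let blocks be shifted without casts between ordinal types. *)
Definition detn n f : A := \det (\matrix_(i < n, j < n) f i j).

Lemma eq_detn n f g :
  (forall i j, (i < n)%N -> (j < n)%N -> f i j = g i j) -> detn n f = detn n g.
Proof. by move=> fg; congr (\det _); apply/matrixP => i j; rewrite !mxE fg. Qed.

Lemma detn_block n m f :
  \matrix_(i < n + m, j < n + m) f i j =
  block_mx (\matrix_(i < n, j < n) f i j) (\matrix_(i < n, j < m) f i (n + j)%N)
    (\matrix_(i < m, j < n) f (n + i)%N j)
    (\matrix_(i < m, j < m) f (n + i)%N (n + j)%N).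
Proof.
by apply/matrixP => i j; rewrite !mxE; case: split_ordP => i' ->;
  rewrite !mxE; case: split_ordP => j' ->; rewrite !mxE.
Qed.

Lemma detn_lblock n m f :
  (forall i j, (i < n)%N -> (j < m)%N -> f i (n + j)%N = 0) ->
  detn (n + m) f = detn n f * detn m (fun i j => f (n + i)%N (n + j)%N).
Proof.
move=> f0; rewrite /detn detn_block.
have -> : \matrix_(i < n, j < m) f i (n + j)%N = 0.
  by apply/matrixP => i j; rewrite !mxE f0.
by rewrite det_lblock.
Qed.

Lemma detn_ublock n m f :
  (forall i j, (i < m)%N -> (j < n)%N -> f (n + i)%N j = 0) ->
  detn (n + m) f = detn n f * detn m (fun i j => f (n + i)%N (n + j)%N).
Proof.
move=> f0; rewrite /detn detn_block.
have -> : \matrix_(i < m, j < n) f (n + i)%N j = 0.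
  by apply/matrixP => i j; rewrite !mxE f0.
by rewrite det_ublock.
Qed.

Lemma detn_lblocks d m f :
  (forall q i j, (q < m)%N -> (i < d * q)%N -> (j < d)%N ->
     f i (d * q + j)%N = 0) ->
  detn (d * m) f =
  \prod_(q < m) detn d (fun i j => f (d * q + i)%N (d * q + j)%N).
Proof.
elim: m => [|m IHm] f0; first by rewrite muln0 big_ord0 /detn det_mx00.
rewrite big_ord_recr /= -IHm => [|q i j qm]; last exact/f0/leqW.
by rewrite mulnS addnC detn_lblock // => i j ? ?; exact: f0.
Qed.

Lemma detn_tperm n f (p q : 'I_n) : p != q ->
  detn n f = - detn n (fun i => f (if i == p then q : nat
                                   else if i == q then p : nat else i)).
Proof.
move=> pq; rewrite /detn.
have -> : \matrix_(i < n, j < n)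
    f (if i == p :> nat then q : nat else if i == q :> nat then p : nat else i) j
    = row_perm (tperm p q) (\matrix_(i < n, j < n) f i j).
  apply/matrixP => i j; rewrite !mxE; congr f.
  by case: tpermP => [->|->|/eqP/negPf ip /eqP/negPf iq];
    rewrite ?eqxx ?[_ == _ :> nat]ip ?[_ == _ :> nat]iq // val_eqE eq_sym
      (negPf pq).
by rewrite row_permE det_mulmx det_perm odd_tperm pq expr1 mulN1r opprK.
Qed.

Lemma detn3 f :
  detn 3 f = f 0%N 0%N * (f 1%N 1%N * f 2%N 2%N - f 1%N 2%N * f 2%N 1%N)
           - f 0%N 1%N * (f 1%N 0%N * f 2%N 2%N - f 1%N 2%N * f 2%N 0%N)
           + f 0%N 2%N * (f 1%N 0%N * f 2%N 1%N - f 1%N 1%N * f 2%N 0%N).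
Proof.
rewrite /detn (expand_det_row _ ord0) !big_ord_recl big_ord0 /cofactor.
rewrite !(expand_det_row _ ord0) !big_ord_recl !big_ord0 /cofactor !det_mx11.
rewrite !mxE /= /bump /=; ring.
Qed.

End NatIndexedDeterminants.

(** * The trace pairing and 3x3 determinants built from 2x2 matrices *)

Section TwoByTwo.
Variable C : comUnitRingType.
Implicit Types (M N X : 'M[C]_2).

Lemma mx2_eq M N : M 0 0 = N 0 0 -> M 0 1 = N 0 1 -> M 1 0 = N 1 0 ->
  M 1 1 = N 1 1 -> M = N.
Proof.
move=> M00 M01 M10 M11; apply/matrixP.
suff ord2P (i : 'I_2) : {i = 0} + {i = 1}.
  by move=> i j; case: (ord2P i) => ->; case: (ord2P j) => ->.
by case: i => -[|[|//]] i2; [left|right]; apply: val_inj.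
Qed.

Lemma mx2M M N i j : (M *m N) i j = M i 0 * N 0 j + M i 1 * N 1 j.
Proof.
rewrite mxE big_ord_recl big_ord1; congr (_ + M i _ * N _ j); exact: val_inj.
Qed.

Lemma mx2_tr M : \tr M = M 0 0 + M 1 1.
Proof.
rewrite /mxtrace big_ord_recl big_ord1; congr (_ + M _ _); exact: val_inj.
Qed.

Lemma mx2_tr0 M : \tr M = 0 -> M 1 1 = - M 0 0.
Proof. by rewrite mx2_tr addrC => /eqP; rewrite addr_eq0 => /eqP. Qed.

(** This is the infinitesimal invariance of tr(MN) under simultaneous conjugation of M and N. *)
Lemma tr_polarized_commutator M N X :
  \tr ((M *m X - X *m M) *m N + (N *m X - X *m N) *m M) = 0.
Proof.
pose addE (P Q : 'M[C]_2) i j : (P + Q) i j = P i j + Q i j := mxE _ _ _ _.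
pose oppE (P : 'M[C]_2) i j : (- P) i j = - P i j := mxE _ _ _ _.
rewrite mx2_tr !(mx2M, addE, oppE); ring.
Qed.

Lemma mx2_det M : \det M = M 0 0 * M 1 1 - M 0 1 * M 1 0.
Proof.
have -> : \det M = detn 2 (fun i j => M (inord i) (inord j)).
  by congr (\det _); apply/matrixP => i j; rewrite mxE !inord_val.
rewrite /detn (expand_det_row _ ord0) !big_ord_recl big_ord0 /cofactor.
rewrite !det_mx11 !mxE /= /bump /=.
have -> : inord 0 = 0 :> 'I_2 by apply/val_inj; rewrite /= inordK.
have -> : inord 1 = 1 :> 'I_2 by apply/val_inj; rewrite /= inordK.
ring.
Qed.

Lemma mx2_inv M : \det M = 1 ->
  ((invmx M 0 0 = M 1 1) * (invmx M 0 1 = - M 0 1)) *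
  ((invmx M 1 0 = - M 1 0) * (invmx M 1 1 = M 0 0)).
Proof.
move=> M1; have Mu : M \in unitmx by rewrite unitmxE M1 unitr1.
pose N : 'M[C]_2 := \matrix_(i, j)
  if i == 0 then (if j == 0 then M 1 1 else - M 0 1)
  else (if j == 0 then - M 1 0 else M 0 0).
suff -> : invmx M = N by rewrite !mxE.
apply: (can_inj (mulKmx Mu)); rewrite mulmxV //.
by apply: mx2_eq; rewrite mx2M !mxE /= -?M1 ?mx2_det; ring.
Qed.

(* Coordinates dual to each other for the trace pairing, see [tr_sl_dual]. *)
Definition sl_co X (q : nat) : C := nth 0 [:: X 0 0; X 0 1; X 1 0] q.
Definition sl_dual M (q : nat) : C := nth 0 [:: M 0 0 - M 1 1; M 1 0; M 0 1] q.

Lemma tr_sl_dual X M : \tr X = 0 ->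
  \tr (X *m M) = \sum_(q < 3) sl_dual M q * sl_co X q.
Proof.
move=> /mx2_tr0 X11; rewrite mx2_tr !mx2M X11 !big_ord_recl big_ord0.
rewrite /sl_dual /sl_co /=; ring.
Qed.

(** The determinant of the three forms X |-> tr(X M_r) on sl_2 in the coordinates [sl_co]; adding
    scalars to the M_r does not change it. *)
Definition sl_vol (M : nat -> 'M[C]_2) : C := detn 3 (fun r => sl_dual (M r)).

Lemma detn_tr (X M : nat -> 'M[C]_2) : (forall l, (l < 3)%N -> \tr (X l) = 0) ->
  detn 3 (fun r l => \tr (X l *m M r)) = sl_vol M * detn 3 (fun q l => sl_co (X l) q).
Proof.
move=> X0; rewrite /sl_vol /detn -det_mulmx; congr (\det _).
apply/matrixP => r l; rewrite !mxE tr_sl_dual ?X0 //.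
by apply: eq_bigr => q _; rewrite !mxE.
Qed.

(** Where [sl_co] reads (a, b, c) on a traceless matrix, [sl_dual] reads (2a, c, b): a factor 2 and
    the sign of one exchange. *)
Lemma sl_vol_tr0 (X : nat -> 'M[C]_2) : (forall l, \tr (X l) = 0) ->
  sl_vol X = - (2 * detn 3 (fun q l => sl_co (X l) q)).
Proof.
move=> X0; rewrite /sl_vol !detn3 /sl_dual /sl_co /= !(mx2_tr0 (X0 _)); ring.
Qed.

Lemma sl_vol_translates X M N : \det X = 1 ->
  sl_vol (nth 0 [:: X; X *m M; X *m N]) = \tr (N *m M *m X) - \tr (M *m N *m X).
Proof.
(* The factor det X makes the right side cubic in X, like the left, and the identity becomes
   polynomial. *)
move=> X1; rewrite -[RHS]mulr1 -X1 mx2_det /sl_vol detn3 /= /sl_dual /=.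
rewrite !mx2_tr !mx2M; ring.
Qed.

Section Pair.
Variables M N : 'M[C]_2.
Hypotheses (M1 : \det M = 1) (N1 : \det N = 1).

Let kappa := \tr (M *m N *m invmx M *m invmx N) - 2.

(** With inverses written as adjugates, this form of [kappa] has degree 2 in M and in N, so the
    identities below become homogeneous polynomial identities. *)
Let kappaE : kappa = \tr (M *m N *m invmx M *m invmx N) - 2 * (\det M * \det N).
Proof. by rewrite M1 N1 !mulr1. Qed.

Let invE := (mx2_inv M1, mx2_inv N1).

Lemma sl_vol_pair1 : sl_vol (nth 0 [:: N; M *m N; M]) = - kappa.
Proof.
rewrite kappaE /sl_vol detn3 /= /sl_dual /= !mx2_tr !mx2M !mx2_det !invE; ring.
Qed.

Lemma sl_vol_pair2 : sl_vol (nth 0 [:: M; N; N *m M]) = kappa.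
Proof.
rewrite kappaE /sl_vol detn3 /= /sl_dual /= !mx2_tr !mx2M !mx2_det !invE; ring.
Qed.

(** By [slot_tr_delta], these three matrices represent the auxiliary forms composed with delta. *)
Lemma sl_vol_delta :
  sl_vol (nth 0 [:: invmx M *m N *m M - N; N *m M - M *m N;
                    invmx N *m M *m N - M]) = - (2 * kappa ^+ 2).
Proof.
(* made homogeneous, the identity holds without using the determinants *)
have -> : nth 0 [:: invmx M *m N *m M - N; N *m M - M *m N;
                    invmx N *m M *m N - M] =
          nth 0 [:: invmx M *m N *m M - \det M *: N; N *m M - M *m N;
                    invmx N *m M *m N - \det N *: M].
  by rewrite M1 N1 !scale1r.
rewrite kappaE /sl_vol detn3 /= /sl_dual /=.
pose scaleE c (P : 'M[C]_2) i j : (c *: P) i j = c * P i j := mxE _ _ _ _.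
pose addE (P Q : 'M[C]_2) i j : (P + Q) i j = P i j + Q i j := mxE _ _ _ _.
pose oppE (P : 'M[C]_2) i j : (- P) i j = - P i j := mxE _ _ _ _.
rewrite !(addE, oppE, scaleE) !mx2_tr !mx2M !mx2_det !invE; ring.
Qed.

End Pair.

End TwoByTwo.

(** * Differentials of trace functions along paths of representations *)

Section Differentials.
Variable R : realType.
Let C := CC R.

Definition mx_derive (P : C -> 'M[C]_2) (D : 'M[C]_2) : Prop :=
  forall a b, is_derive (0 : C) (1 : C) (fun s => P s a b) (D a b).

Lemma mx_deriveM P Q D E : mx_derive P D -> mx_derive Q E ->
  mx_derive (fun s => P s *m Q s) (D *m Q 0 + P 0 *m E).
Proof.
move=> PD QE a b.
have -> : (fun s => (P s *m Q s) a b) =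
    (fun s => P s a 0) * (fun s => Q s 0 b) + (fun s => P s a 1) * (fun s => Q s 1 b).
  by apply/funext => s; rewrite mx2M.
have PQE := is_deriveD (is_deriveM (PD a 0) (QE 0 b)) (is_deriveM (PD a 1) (QE 1 b)).
apply: (is_derive_eq PQE); rewrite mxE !mx2M /GRing.scale /=; ring.
Qed.

Lemma mx_derive_tr P D : mx_derive P D ->
  is_derive (0 : C) (1 : C) (fun s => \tr (P s)) (\tr D).
Proof.
move=> PD; rewrite mx2_tr.
have -> : (fun s => \tr (P s)) = (fun s => P s 0 0) + (fun s => P s 1 1).
  by apply/funext => s; rewrite mx2_tr.
exact: is_deriveD.
Qed.

Lemma mx_derive_cst D : mx_derive (fun=> D) 0.
Proof. by move=> a b; rewrite mxE; exact: is_derive_cst. Qed.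

Lemma mx_derive_affine D E : mx_derive (fun s => D + s *: E) E.
Proof.
move=> a b.
have -> : (fun s : C => (D + s *: E) a b) = cst (D a b) + E a b *: id.
  by apply/funext => s; rewrite !mxE mulrC.
have DE := is_deriveD (is_derive_cst (D a b) (0 : C) (1 : C))
  (is_deriveZ (E a b) (is_derive_id (0 : C) (1 : C))).
by apply: (is_derive_eq DE); rewrite add0r /GRing.scale /= mulr1.
Qed.

Lemma det_unipotent (c : C) (N : 'M[C]_2) :
  \tr N = 0 -> \det N = 0 -> \det (1%:M + c *: N) = 1.
Proof.
move=> trN detN.
have -> : \det (1%:M + c *: N) = 1 + c * \tr N + c ^+ 2 * \det N.
  by rewrite mx2_tr !mx2_det !mxE /= mulr1n mulr0n; ring.
by rewrite trN detN !mulr0 !addr0.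
Qed.

(** A factor 1 + sN with N nilpotent has determinant 1 for every s, and the velocities of such
    factors add at s = 0, where each is the identity. *)
Lemma SL2_path (D : 'M[C]_2) : \tr D = 0 ->
  exists P : C -> SL2 R, P 0 = 1%g /\ mx_derive (fun s => P s) D.
Proof.
move=> D0.
(* a traceless matrix is a sum of three nilpotent ones *)
pose N (q : nat) : 'M[C]_2 := \matrix_(a, b) nth 0
  (nth [::] [:: [:: D 0 0; - D 0 0; D 0 0; - D 0 0];
      [:: 0; D 0 1 + D 0 0; 0; 0]; [:: 0; 0; D 1 0 - D 0 0; 0]] q) (a * 2 + b).
have N1 q (s : C) : \det (1%:M + s *: N q) == 1.
  apply/eqP/det_unipotent; rewrite ?mx2_tr ?mx2_det !mxE /=;
  by case: q => [|[|[|[|q]]]] /=; ring.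
pose U q s := MkSL2 (N1 q s).
exists (fun s => U 0%N s * U 1%N s * U 2%N s)%g; split.
  have U0 q : U q 0 = 1%g by apply: val_inj; rewrite /= scale0r addr0.
  by rewrite !U0 !mulg1.
(* D is put in the shape that the product rule gives at s = 0. *)
have -> : D = (N 0%N *m (1%:M + 0 *: N 1%N) + (1%:M + 0 *: N 0%N) *m N 1%N)
    *m (1%:M + 0 *: N 2%N) + (1%:M + 0 *: N 0%N) *m (1%:M + 0 *: N 1%N) *m N 2%N.
  rewrite !scale0r !addr0 !mulmx1 !mul1mx.
  by apply: mx2_eq; rewrite ?(mx2_tr0 D0) !mxE /=; ring.
by do 2?apply: mx_deriveM; apply: mx_derive_affine.
Qed.

Variables (k : nat) (F : groupType) (gam : 'I_k -> F).
Hypothesis hF : is_free_group gam.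
Variable rho : rep R F.

(** Freeness extends the values P_i(s) rho(gamma_i) to a representation, for each s separately. *)
Lemma tangent_path_exists u : exists p, tangent_path gam rho u p.
Proof.
have u0 i : \tr (vsval (u i)) = 0 by apply/eqP; rewrite -sl2_spaceE subvsP.
have [P PP] := choice (fun i => SL2_path (u0 i)).
have [p pP] := choice (fun s => hF (fun i => P i s * rho (gam i))%g).
exists p; split=> [x|].
  have [_ p0] := pP 0; rewrite (p0 rho) // => i.
  by have [-> _] := PP i; rewrite mul1g.
exists 0 => i a b.
have -> : (fun s => ((p s (gam i) : 'M[C]_2) *m invmx (rho (gam i))) a b) =
    (fun s => (P i s : 'M[C]_2) a b).
  apply/funext => s; have [-> _] := pP s.
  by rewrite /= -mulmxA mulmxV ?SL2_unit // mulmx1.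
have -> : (u + delta gam rho 0) i = u i.
  have Ad0 : Ad (rho (gam i)) 0 = 0.
    by apply: val_inj; rewrite [LHS]AdE linear0 mul0mx.
  by rewrite !ffunE subr0 Ad0 addr0.
by have [_ ] := PP i; apply.
Qed.

(** The existence of a path rules out the default value 0 of [dif], and uniqueness of derivatives
    gives d along whichever path is picked. *)
Lemma dif_eq f u d :
  (forall p, tangent_path gam rho u p ->
     is_derive (0 : C) (1 : C) (fun s => f (conj_class (p s))) d) ->
  dif gam f rho u = d.
Proof.
move=> fd; rewrite /dif; case: xgetP => [e _ [p [/fd pd pd']]|].
  by rewrite -(@derive_val _ _ _ _ _ _ _ pd) -(@derive_val _ _ _ _ _ _ _ pd').
have [p pu] := tangent_path_exists u.
by move/(_ d) => /= []; exists p; split; last exact: fd.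
Qed.

Let A i : 'M[C]_2 := rho (gam i).

Definition slot_tr i (M : 'M[C]_2) (u : C1 R k) : C := \tr (vsval (u i) *m M).

Definition dtr i := slot_tr i (A i).

(** The product rule for tr(A_i A_j), with the second term rotated cyclically so that u_j comes
    first. *)
Definition dtr2 i j (u : C1 R k) : C :=
  slot_tr i (A i *m A j) u + slot_tr j (A j *m A i) u.

Lemma deltaM X i :
  vsval (delta gam rho X i) *m A i = A i *m vsval X - vsval X *m A i.
Proof. by rewrite ffunE linearB /= AdE mulmxBl mulmxKV ?SL2_unit. Qed.

Lemma slot_tr_delta i M N X : invmx (A i) *m M *m A i = N ->
  slot_tr i M (delta gam rho X) = \tr (vsval X *m (N - M)).
Proof.
move=> <-; rewrite /slot_tr ffunE linearB /= AdE mulmxBl mulmxBr !raddfB /=.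
by congr (_ - _); rewrite -!mulmxA mxtrace_mulC -!mulmxA.
Qed.

(** Coboundaries are the velocities of conjugation, along which traces are constant; hence the trace
    differentials descend to H^1. *)
Lemma dtr_delta i X : dtr i (delta gam rho X) = 0.
Proof. by rewrite /dtr /slot_tr deltaM raddfB /= mxtrace_mulC subrr. Qed.

Lemma dtr2_delta i j X : dtr2 i j (delta gam rho X) = 0.
Proof.
rewrite /dtr2 /slot_tr -mxtraceD !mulmxA !deltaM.
exact: tr_polarized_commutator.
Qed.

Lemma slot_tr_linear i M a u v :
  slot_tr i M (a *: u + v) = a * slot_tr i M u + slot_tr i M v.
Proof.
by rewrite /slot_tr !ffunE linearP /= mulmxDl mxtraceD -scalemxAl mxtraceZ.
Qed.

Lemma dtr2_linear i j a u v : dtr2 i j (a *: u + v) = a * dtr2 i j u + dtr2 i j v.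
Proof. by rewrite /dtr2 !slot_tr_linear mulrDr addrACA. Qed.

Lemma tangent_path_derive u p : tangent_path gam rho u p ->
  exists X, forall i, mx_derive (fun s => p s (gam i))
    (vsval ((u + delta gam rho X) i) *m A i).
Proof.
move=> [p0 [X pX]]; exists X => i.
have -> : (fun s => SL2val (p s (gam i))) =
    (fun s => (p s (gam i) *m invmx (A i)) *m A i).
  by apply/funext => s; rewrite mulmxKV ?SL2_unit.
(* The added zero term is the contribution of the constant factor in [mx_deriveM]. *)
rewrite -[_ *m A i]addr0 -[X in _ + X](mulmx0 _ (p 0 (gam i) *m invmx (A i))).
exact: mx_deriveM (pX i) (mx_derive_cst _).
Qed.

Lemma dif_trf i : dif gam (@trf R F (gam i)) rho = dtr i.
Proof.
apply/funext => u; apply: dif_eq => p /tangent_path_derive[X pX].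
under eq_fun do rewrite trfE.
have -> : dtr i u = dtr i (u + delta gam rho X).
  by rewrite addrC -[delta _ _ _]scale1r [RHS]slot_tr_linear mul1r
    -/(dtr i) dtr_delta add0r.
exact: mx_derive_tr.
Qed.

Lemma dif_trf2 i j : dif gam (@trf R F (gam i * gam j)%g) rho = dtr2 i j.
Proof.
apply/funext => u; apply: dif_eq => p pu.
have [X pX] := tangent_path_derive pu; have [p0 _] := pu.
under eq_fun do rewrite trfE gmulfM.
have -> : dtr2 i j u = dtr2 i j (u + delta gam rho X).
  by rewrite addrC -[delta _ _ _]scale1r dtr2_linear mul1r dtr2_delta add0r.
have := mx_derive_tr (mx_deriveM (pX i) (pX j)).
rewrite !p0 [\tr (_ + _)]mxtraceD [\tr (SL2val (rho (gam i)) *m _)]mxtrace_mulC.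
by rewrite -!mulmxA.
Qed.

End Differentials.

(** * Indexing of lists and change of basis in C^1 *)

Lemma nth_allpairs (S T U : Type) (f : S -> T -> U) x0 y0 z0 s t n i j :
  size t = n -> (i < size s)%N -> (j < n)%N ->
  nth z0 [seq f x y | x <- s, y <- t] (n * i + j) = f (nth x0 s i) (nth y0 t j).
Proof.
move=> <-; elim: s i => // x s IHs [_|i is_] jt /=; rewrite nth_cat size_map.
  by rewrite muln0 jt (nth_map y0).
by rewrite mulnS -addnA ltnNge leq_addr addKn IHs.
Qed.

(** On an explicit list the [foldr] hypothesis unfolds to a conjunction, proved by successive
    [split]. *)
Lemma nth_foldr_and (T : Type) (P : T -> Prop) x0 s :
  foldr (fun x => and (P x)) True s ->
  forall i, (i < size s)%N -> P (nth x0 s i).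
Proof. by elim: s => //= x s IHs [Px /IHs Ps] [|i] //; exact: Ps. Qed.

Section Brackets.
Variables (R : realType) (k : nat).
Let C := CC R.

Definition linear_form (V : lmodType C) (f : V -> C) : Prop :=
  forall a u v, f (a *: u + v) = a * f u + f v.

Lemma linear_form_sum (V : lmodType C) (f : V -> C) n (a : 'I_n -> C) (v : 'I_n -> V) :
  linear_form f -> f (\sum_i a i *: v i) = \sum_i a i * f (v i).
Proof.
move=> fL; have f0 : f 0 = 0.
  by have /eqP := fL 1 0 0; rewrite scaler0 add0r mul1r addrC -subr_eq subrr => /eqP.
by elim/big_rec2: _ => // i x y _ <-; rewrite fL.
Qed.

(** The matrix of values on a is the matrix of values on b times the coordinate matrix of a in b. *)
Lemma detn_bracket (V : vectType C) (b a : seq V) (f : nat -> V -> C) :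
  (forall v, v \in <<b>>%VS) ->
  (forall r, (r < size b)%N -> linear_form (f r)) ->
  detn (size b) (fun r l => f r b`_l) * bracket a b =
  detn (size b) (fun r j => f r a`_j).
Proof.
move=> b_span fL; rewrite /detn /bracket -det_mulmx; congr (\det _).
apply/matrixP => r j; rewrite !mxE.
have aj := @coord_span _ _ _ (in_tuple b) _ (b_span a`_j).
rewrite [in RHS]aj linear_form_sum; last exact: fL.
by apply: eq_bigr => l _; rewrite !mxE mulrC.
Qed.

Definition slot (i : 'I_k) (X : sl2 R) : C1 R k := [ffun j => if j == i then X else 0].

Lemma C1_basis_span (c0 : seq (sl2 R)) : basis_of fullv c0 ->
  forall u : C1 R k, u \in <<C1_basis k c0>>%VS.
Proof.
move=> /andP[/eqP c0_span _] u.
have -> : u = \sum_i slot i (u i).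
  apply/ffunP => j; rewrite sum_ffunE (bigD1 j) //= ffunE eqxx big1 ?addr0 // => i.
  by rewrite ffunE eq_sym => /negPf ->.
apply: rpred_sum => i _.
have ui : u i \in <<in_tuple c0>>%VS by rewrite c0_span memvf.
rewrite [u i](coord_span ui).
have -> : slot i (\sum_l coord (in_tuple c0) l (u i) *: (in_tuple c0)`_l) =
    \sum_l coord (in_tuple c0) l (u i) *: slot i c0`_l.
  apply/ffunP => j; rewrite sum_ffunE ffunE; case: eqP => ji.
    by apply: eq_bigr => l _; rewrite !ffunE ji eqxx.
  by rewrite big1 // => l _; rewrite !ffunE; case: eqP => // _; rewrite scaler0.
apply: rpred_sum => l _; apply/rpredZ/memv_span/allpairsP.
by exists (i, c0`_l); split; rewrite ?mem_enum // mem_nth.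
Qed.

Lemma slot_tr_slot i j M (X : sl2 R) :
  slot_tr i M (slot j X) = if i == j then \tr (vsval X *m M) else 0.
Proof.
by rewrite /slot_tr ffunE; case: eqP => // _; rewrite linear0 mul0mx linear0.
Qed.

End Brackets.

(** * The volume of an orthonormal basis of sl_2 *)

Section OrthonormalBasis.
Variables (R : realType) (c0 : 3.-tuple (sl2 R)).
Hypothesis c0_on : orthonormal_basis c0.

Let c l : 'M[CC R]_2 := vsval (c0`_l).

Lemma tr_c0 l : \tr (c l) = 0.
Proof. by apply/eqP; rewrite -sl2_spaceE subvsP. Qed.

Definition vol_c0 : CC R := detn 3 (fun q l => sl_co (c l) q).

(** The Gram matrix of the trace form on c0 is minus the identity, of determinant -1 in dimension 3;
    by [detn_tr] and [sl_vol_tr0] this determinant is also -2 d^2. *)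
Lemma vol_c0_sqr : (vol_c0 * sqrtC 2) ^+ 2 = 1.
Proof.
rewrite exprMn sqrtCK.
have : sl_vol c * vol_c0 = - 1.
  rewrite -detn_tr => [|l _]; last exact: tr_c0.
  rewrite /detn; have -> : \matrix_(r < 3, l < 3) \tr (c l *m c r) = - 1%:M.
    apply/matrixP => r l; rewrite !mxE -[LHS]opprK; congr (- _).
    by have [_ /(_ l r)] := c0_on; rewrite /Bform !(tnth_nth 0) eq_sym.
  by rewrite -scaleN1r detZ det1 mulr1 -signr_odd expr1.
rewrite (sl_vol_tr0 tr_c0) -/vol_c0.
by rewrite mulNr => /oppr_inj vol1; rewrite -[RHS]vol1; ring.
Qed.

End OrthonormalBasis.

(** * The 3k linear forms and their block structure *)

Section TraceCoordinates.
Variables (R : realType) (m : nat).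
Let k := m.+3.
Let C := CC R.
Variables (F : groupType) (gam : 'I_k -> F).
Hypothesis hF : is_free_group gam.
Variables (c0 : 3.-tuple (sl2 R)).
Hypothesis c0_on : orthonormal_basis c0.
Variable rho : rep R F.

(* The generators are numbered from 0 here: [A i] is the image of [gen gam i.+1]. *)
Let A (i : nat) : 'M[C]_2 := rho (gam (inord i)).

Lemma genE j : (j < k)%N -> gen gam j.+1 = gam (inord j).
Proof.
move=> jk; rewrite /gen /=; case: insubP => [i _ ij /=|/negP//].
by congr gam; apply: val_inj; rewrite /= inordK.
Qed.

Let tr_form (i : nat) := slot_tr (k := k) (R := R) (inord i).
Let dt (i : nat) := dtr gam rho (inord i).
Let dt2 (i j : nat) := dtr2 gam rho (inord i) (inord j).

Let aux_forms := [:: tr_form 0 (A 1); tr_form 0 (A 0 *m A 1); tr_form 1 (A 0)].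

(** Listing the last k - 2 triples by pairs (i, l) lets [nth_allpairs] locate each form; the range
    3..k becomes 2..k-1. *)
Lemma trace_formsE : trace_forms gam rho =
  [:: dt 0; dt 1; dt2 0 1] ++
  [seq nth (fun=> 0) [:: dt i; dt2 0 i; dt2 1 i] l | i <- iota 2 m.+1, l <- iota 0 3].
Proof.
rewrite /trace_forms !genE // !dif_trf // dif_trf2 //; congr (_ ++ flatten _).
rewrite /index_iota (_ : k.+1 - 3 = m.+1)%N; last by rewrite /k !subSS subn0.
rewrite (iotaDl 1 2) -map_comp; apply/eq_in_map => i.
rewrite mem_iota => /andP[_ ik] /=; rewrite add1n !genE ?dif_trf ?dif_trf2 //.
all: by rewrite /k -addn2 addnC.
Qed.

Lemma size_trace_forms : size (trace_forms gam rho) = (3 * k - 3)%N.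
Proof.
rewrite trace_formsE size_cat size_allpairs !size_iota.
by rewrite [(3 * k)%N]mulnC [(k * 3)%N]mulSn addKn.
Qed.

Let forms := aux_forms ++ trace_forms gam rho.

Lemma trace_forms_delta i X :
  (i < size (trace_forms gam rho))%N ->
  nth (fun=> 0) (trace_forms gam rho) i (delta gam rho X) = 0.
Proof.
move: i; apply: (nth_foldr_and (P := fun f => f (delta gam rho X) = 0)).
rewrite trace_formsE; do 2 (split; first exact: dtr_delta).
split; first exact: dtr2_delta.
elim: (iota 2 m.+1) => //= i s IHs.
by split; [exact: dtr_delta|split; [exact: dtr2_delta|split; [exact: dtr2_delta|]]].
Qed.

Lemma forms_linear r : (r < size forms)%N ->
  linear_form (V := C1 R k) (nth (fun=> 0) forms r).
Proof.
have tL i M : linear_form (V := C1 R k) (slot_tr i M).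
  by move=> a u v; exact: slot_tr_linear.
have t2L i j : linear_form (V := C1 R k) (dt2 i j).
  by move=> a u v; exact: dtr2_linear.
move: r; apply: nth_foldr_and; rewrite foldr_cat; do 3 (split; first exact: tL).
rewrite trace_formsE; do 2 (split; first exact: tL); split; first exact: t2L.
elim: (iota 2 m.+1) => //= i s IHs.
by split; [exact: tL|split; [exact: t2L|split; [exact: t2L|]]].
Qed.

(* The rows of [forms] with the third and fourth exchanged, indexed by blocks of
   three, so that the matrix in the basis [C1_basis c0] is block triangular. *)
Let row q : nat -> C1 R k -> C := nth (fun=> 0)
  match q with
  | 0 => [:: tr_form 0 (A 1); tr_form 0 (A 0 *m A 1); dt 0]
  | 1 => [:: tr_form 1 (A 0); dt 1; dt2 0 1]
  | _ => [:: dt q; dt2 0 q; dt2 1 q]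
  end.

(** The matrices that represent block q on slot q. Their [sl_vol] is -kappa for q = 0, kappa for q =
    1 and -tau q afterwards. *)
Let diag q : nat -> 'M[C]_2 := nth 0
  match q with
  | 0 => [:: A 1; A 0 *m A 1; A 0]
  | 1 => [:: A 0; A 1; A 1 *m A 0]
  | _ => [:: A q; A q *m A 0; A q *m A 1]
  end.

(** The forms of block q read only slots up to q; past position 2 the default form is zero. *)
Lemma row_slot_lt q s i X : (q < s < k)%N -> row q i (slot (inord s) X) = 0.
Proof.
move=> /andP[qs sk].
have E j : (j <= q)%N -> (inord j == inord s :> 'I_k) = false.
  move=> jq; apply/negbTE/eqP => /(congr1 val) /=.
  have jk : (j < k)%N by apply: leq_ltn_trans sk; exact: leq_trans (ltnW qs).
  by rewrite !inordK // => js; move: jq; rewrite js leqNgt qs.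
rewrite /row /dt /dt2 /dtr /dtr2 /tr_form.
case: q qs E => [|[|q]] qs E; case: i => [|[|[|i]]] /=;
  by rewrite ?slot_tr_slot ?E ?addr0 ?nth_nil.
Qed.

Lemma row_slot_diag q i X : (q < k)%N -> (i < 3)%N ->
  row q i (slot (inord q) X) = \tr (vsval X *m diag q i).
Proof.
move=> qk i3.
have E j : (j < q)%N -> (inord j == inord q :> 'I_k) = false.
  move=> jq; apply/negbTE/eqP => /(congr1 val) /=.
  by rewrite !inordK // => [jq'|]; [rewrite jq' ltnn in jq | exact: ltn_trans qk].
rewrite /row /diag /dt /dt2 /dtr /dtr2 /tr_form.
case: q qk E => [|[|q]] qk E; case: i i3 => [|[|[|//]]] /= _;
  by rewrite !slot_tr_slot ?eqxx ?E ?add0r.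
Qed.

Lemma size_forms : size forms = (3 * k)%N.
Proof. by rewrite size_cat size_trace_forms subnKC // leq_pmulr. Qed.

Lemma forms_row q i : (q < k)%N -> (i < 3)%N ->
  let r := (3 * q + i)%N in
  nth (fun=> 0) forms (if r == 2 then 3 else if r == 3 then 2 else r)%N = row q i.
Proof.
rewrite /forms trace_formsE => qk i3 /=.
case: q qk => [|[|q]] qk; first by case: i i3 => [|[|[|]]].
  by case: i i3 => [|[|[|]]].
(* The first two blocks fill six positions; the others come from the list of pairs. *)
have -> : (3 * q.+2 + i = 6 + (3 * q + i))%N by rewrite 2!mulnS !addnA.
transitivity (nth (fun=> 0) [seq nth (fun=> 0) [:: dt i; dt2 0 i; dt2 1 i] l
    | i <- iota 2 m.+1, l <- iota 0 3] (3 * q + i)); first by [].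
by rewrite (nth_allpairs _ 0%N 0%N) ?size_iota // !nth_iota.
Qed.

Lemma C1_basis_nth s j : (s < k)%N -> (j < 3)%N ->
  (C1_basis k c0)`_(3 * s + j) = slot (inord s) c0`_j.
Proof.
move=> sk j3; rewrite (nth_allpairs _ ord0 0 _ (size_tuple c0)) ?size_enum_ord //.
congr slot; by apply: val_inj; rewrite /= nth_enum_ord // inordK.
Qed.

Lemma detn_forms :
  detn (3 * k) (fun r j => nth (fun=> 0) forms r (C1_basis k c0)`_j) =
  - \prod_(q < k) (sl_vol (diag q) * vol_c0 c0).
Proof.
have k4 : (3 < 3 * k)%N by rewrite mulnC.
(* Exchanging rows 2 and 3, counted from 0, produces the sign. *)
rewrite (detn_tperm _ (p := Ordinal (ltnW k4)) (q := Ordinal k4)) //; congr (- _).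
rewrite detn_lblocks => [|s r j sk rs j3].
  apply: eq_bigr => q _; rewrite -detn_tr => [|l _]; last exact: tr_c0.
  apply: eq_detn => i j i3 j3; rewrite C1_basis_nth //.
  by have /= -> := forms_row (ltn_ord q) i3; rewrite row_slot_diag.
(* Row r has position r mod 3 in block r / 3, which precedes block s. *)
have rq : (r %/ 3 < s)%N by rewrite ltn_divLR // mulnC.
rewrite C1_basis_nth // {1 2 3}(divn_eq r 3) mulnC.
have /= -> := @forms_row (r %/ 3) (r %% 3) (ltn_trans rq sk) (@ltn_pmod r 3 isT).
by rewrite row_slot_lt // rq.
Qed.

Let kappa : C := \tr (A 0 *m A 1 *m invmx (A 0) *m invmx (A 1)) - 2.
Let tau (q : nat) : C := \tr (A 0 *m A 1 *m A q) - \tr (A 1 *m A 0 *m A q).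

Lemma Omega_wedge (h : seq (C1 R k)) :
  (kappa * vol_c0 c0) ^+ 2 * \prod_(q < m.+1) (- tau q.+2 * vol_c0 c0) *
    Omega gam c0 rho h =
  - (2 * kappa ^+ 2) * vol_c0 c0 * wedge (trace_forms gam rho) h.
Proof.
have detA i : \det (A i) = 1 by exact: SL2_det.
have sb : size (C1_basis k c0) = (3 * k)%N.
  by rewrite size_allpairs size_enum_ord size_tuple mulnC.
have -> : (kappa * vol_c0 c0) ^+ 2 * \prod_(q < m.+1) (- tau q.+2 * vol_c0 c0) =
    detn (size (C1_basis k c0))
      (fun r j => nth (fun=> 0) forms r (C1_basis k c0)`_j).
  (* The two leading blocks give -kappa d and kappa d; the sign of the row exchange turns their
     product into (kappa d)^2. *)
  rewrite sb detn_forms; do 2 rewrite [in RHS]big_ord_recl; rewrite /= mulrA -!mulNr.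
  rewrite sl_vol_pair1 // sl_vol_pair2 //.
  rewrite -/kappa; congr (_ * _); first by ring.
  by apply: eq_bigr => q _; rewrite sl_vol_translates // -opprB.
rewrite detn_bracket; first last.
- by move=> r; rewrite sb -size_forms; exact: forms_linear.
- by apply: C1_basis_span; case: c0_on.
pose v := map (delta gam rho) c0 ++ h.
have vl j : (j < 3)%N -> v`_j = delta gam rho c0`_j.
  by move=> j3; rewrite nth_cat size_map size_tuple j3 (nth_map 0) ?size_tuple.
have vr j : v`_(3 + j) = h`_j.
  by rewrite nth_cat size_map size_tuple ltnNge leq_addr addKn.
have conj01 : invmx (A 0) *m (A 0 *m A 1) *m A 0 = A 1 *m A 0.
  by rewrite mulmxA mulVmx ?SL2_unit // mul1mx.
have formsr i : nth (fun=> 0) forms (3 + i) = nth (fun=> 0) (trace_forms gam rho) i.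
  by rewrite nth_cat /= addKn.
(* The trace forms vanish on delta c0, so the lower left block is zero. *)
rewrite sb -(@subnKC 3 (3 * k)) ?leq_pmulr // detn_ublock => [|i j iT j3]; last first.
  by rewrite formsr vl // trace_forms_delta // size_trace_forms.
congr (_ * _).
  rewrite -(sl_vol_delta (detA 0%N) (detA 1%N)) -detn_tr => [|l _]; last exact: tr_c0.
  apply: eq_detn => i j i3 j3; rewrite vl // nth_cat i3.
  case: i i3 => [|[|[|//]]] /= _; exact: slot_tr_delta.
rewrite /wedge -[\det _]/(detn _
  (fun i j => nth (fun=> 0) (trace_forms gam rho) i h`_j)) size_trace_forms.
apply: eq_detn => i j iT jh.
by rewrite formsr vr.
Qed.

End TraceCoordinates.

(** * The volume formula and its sign *)

Lemma rep_inv (R : realType) (F : groupType) (rho : rep R F) x :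
  rho x^-1%g = (rho x)^-1%g.
Proof.
have rho1 : rho 1%g = 1%g by apply: (mulgI (rho 1%g)); rewrite -gmulfM !mulg1.
by apply: (mulgI (rho x)); rewrite -gmulfM !mulgV.
Qed.

Theorem theorem5 (R : realType) (k : nat) (hk : (3 <= k)%N)
  (F : groupType) (gam : 'I_k -> F) (hF : is_free_group gam)
  (c0 : 3.-tuple (sl2 R)) (hc0 : orthonormal_basis c0) :
  exists2 eps : CC R, eps = 1 \/ eps = -1 &
    forall rho : rep R F, (Rstar R F `\` crit R gam) (conj_class rho) ->
    forall h : (3 * k - 3).-tuple (C1 R k), H1_basis gam rho h ->
      Omega gam c0 rho h = eps * trace_volume gam rho h.
Proof.
case: k hk gam hF => [|[|[|m]]] // _ gam hF.
(* Since 2 d^2 = 1, [eta] is a sign. It depends on c0 only, so one sign serves every rho. The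
   exponent m + 2 = k - 1 counts one [eta] for each i >= 3 and one for the leading constant. *)
pose d := vol_c0 c0; pose eta := - (d * sqrtC 2).
have eta2 : eta ^+ 2 = 1 by rewrite sqrrN vol_c0_sqr.
have etaX2 : (eta ^+ m.+2) ^+ 2 = 1 by rewrite exprAC eta2 expr1n.
exists (eta ^+ m.+2).
  by move/eqP: etaX2; rewrite sqrf_eq1 => /orP[] /eqP; [left|right].
move=> rho [good_rho not_crit] h _.
pose A (i : nat) : 'M[CC R]_2 := rho (gam (inord i)).
pose kappa : CC R := \tr (A 0 *m A 1 *m invmx (A 0) *m invmx (A 1)) - 2.
pose tau q := \tr (A 0 *m A 1 *m A q) - \tr (A 1 *m A 0 *m A q).
have d0 : d != 0.
  by apply: contra_eq_neq (vol_c0_sqr hc0) => d0; rewrite -/d d0 mul0r expr0n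
    eq_sym oner_eq0.
have g1 : gen gam 1 = gam (inord 0) by exact: genE.
have g2 : gen gam 2 = gam (inord 1) by exact: genE.
have gq q : (q < m.+1)%N -> gen gam q.+3 = gam (inord q.+2) by move=> qm; exact: genE.
have kappa0 : kappa != 0.
  apply: contra_not_neq not_crit => /subr0_eq kappa0; split; first exact: good_rho.
  by right; rewrite /= trfE g1 g2 !gmulfM !rep_inv.
have tau0 q : (q < m.+1)%N -> tau q.+2 != 0.
  move=> qm; apply: contra_not_neq not_crit => /subr0_eq tau0.
  split; first exact: good_rho.
  left; exists q.+3; first exact: qm.
  by rewrite /= !trfE g1 g2 (gq _ qm) !gmulfM; exact: tau0.
have volE : trace_volume gam rho h = 2 * sqrtC 2 *
    (\prod_(q < m.+1) (sqrtC 2 / tau q.+2)) * wedge (trace_forms gam rho) h.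
  rewrite /trace_volume (big_addn 0 _ 3) big_mkord; congr (_ * _ * _).
  apply: eq_bigr => q _.
  by rewrite addn3 !trfE g1 g2 (gq _ (ltn_ord q)) !gmulfM.
have P0 : \prod_(q < m.+1) (- tau q.+2 * d) != 0.
  apply/prodf_neq0 => i _; rewrite mulf_neq0 // oppr_eq0.
  exact: tau0 (ltn_ord i).
(* In each factor tau cancels, leaving -(d sqrt 2) = eta. *)
have PE : \prod_(q < m.+1) (- tau q.+2 * d) * \prod_(q < m.+1) (sqrtC 2 / tau q.+2) =
    eta ^+ m.+1.
  rewrite -big_split -[in RHS](card_ord m.+1) -prodr_const; apply: eq_bigr => i _ /=.
  by have := tau0 i (ltn_ord i); rewrite /eta => tq; field.
(* It suffices to compare both sides after multiplication by the nonzero factor of [Omega_wedge]. *)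
apply: (mulfI (mulf_neq0 (expf_neq0 2 (mulf_neq0 kappa0 d0)) P0)).
rewrite (Omega_wedge hF hc0) volE -/kappa -/d.
set W := wedge _ _; set P := \prod_(q < m.+1) _ in PE *.
set Q := \prod_(q < m.+1) _ in PE *.
(* The inserted factor is eta * eta^(m+1) * eta^(m+2) = 1; its first [eta] matches d sqrt 2 from the
   leading constant. *)
transitivity (- (2 * kappa ^+ 2) * d * W * (eta * (P * Q) * eta ^+ m.+2)).
  by rewrite PE -exprS -expr2 etaX2 mulr1.
by rewrite [in eta * _]/eta; move: (eta ^+ m.+2) => E; ring.
Qed.
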